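(* Let $G=(\mathcal V,\mathcal E)$ be a finite undirected graph with $n=|\mathcal V|$ nodes and centrality metric $v:\mathcal V\to(0,\infty)$, and let $\mathbf M_G=\mathbf V^{-1}\mathbf A$. The following hold for the spectrum of $\mathbf M_G$. (1) If $G$ has multiple connected components $\mathcal C\subset\mathcal V$, each inducing a subgraph $G_{\mathcal C}$ of $G$, then a complete set of eigenvectors of $\mathbf M_G$ can be constructed from the eigenvectors of the different $\mathbf M_{G_{\mathcal C}}$, where eigenvectors of $\mathbf M_{G_{\mathcal C}}$ are extended to have dimension $n$ by adding zero entries in all positions corresponding to nodes not in $\mathcal C$. (2) The mean $\mu(\mathbf M_G)$ and standard deviation $\sigma(\mathbf M_G)$ of the spectrum of $\mathbf M_G$ are $$\mu(\mathbf M_G)=\frac1n\sum_{i=1}^n\frac1{v(i)},\qquad \sigma(\mathbf M_G)=\left[\left(\frac1n\sum_{(i,j)\in\mathcal E}\frac1{v(i)v(j)}\right)-\mu(\mathbf M_G)^2\right]^{1/2}.$$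
   Context: $\mathbf A=[a_{i,j}]$ is the (symmetric) adjacency matrix of $G$: $a_{i,j}=1$ if $(i,j)\in\mathcal E$ and $0$ otherwise. A centrality metric assigns to each node $i$ a number $v(i)$; $\mathbf V$ is the diagonal matrix with entries $v(i)$. The Markov averaging operator acts on functions $\varphi$ on $\mathcal V$ by $(\mathbf M_G\varphi)(i)=\frac1{v(i)}\sum_{j\in\mathcal N_i}\varphi(j)$ with $\mathcal N_i$ the neighborhood of $i$; for a component $\mathcal C$, $\mathbf M_{G_{\mathcal C}}$ is the same operator for the subgraph $G_{\mathcal C}$ with $v$ restricted to $\mathcal C$. The spectrum is the list of eigenvalues with multiplicity; mean and standard deviation are those of this list (uniform weights $1/n$). The sum over $(i,j)\in\mathcal E$ runs over ordered pairs, i.e. it equals $\sum_i\sum_{j\in\mathcal N_i}$.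
   Formalization: The formula for the mean is stated only for graphs in which every node has a self-loop; without this it fails (two nodes joined by an edge, v=1: mean 0, not 1). It holds exactly in that case; all other claims are for every undirected graph. *)

(* Defs.v *)
From HB Require Import structures.
From mathcomp Require Import all_boot all_order all_algebra.

Set Implicit Arguments.
Unset Strict Implicit.
Unset Printing Implicit Defensive.

Import Order.TTheory GRing.Theory Num.Theory.

Local Open Scope ring_scope.

(** A graph on the nodes ['I_n] is given by its edge relation [e : rel 'I_n],
    read as the set of ordered pairs [(i, j)] with [e i j]; undirected means
    [symmetric e].  Loops are allowed: the trace of [V^-1 A] only sees the
    looped nodes, so it is the sum of all the [1 / v i] exactly when every node
    carries a loop, i.e. when [reflexive e]. *)

Definition adjacency_mx (R : rcfType) (n : nat) (e : rel 'I_n) : 'M[R]_n :=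
  \matrix_(i, j) (e i j)%:R.

Definition centrality_mx (R : rcfType) (n : nat) (v : 'I_n -> R) : 'M[R]_n :=
  diag_mx (\row_i v i).

Definition markov_mx (R : rcfType) (n : nat) (e : rel 'I_n) (v : 'I_n -> R) :
    'M[R]_n :=
  invmx (centrality_mx v) *m adjacency_mx R e.

(** The connected components, for symmetric [e] (so that [connect e] is an
    equivalence relation). *)
Definition components (n : nat) (e : rel 'I_n) : {set {set 'I_n}} :=
  equivalence_partition (connect e) [set: 'I_n].

(** The nodes of the subgraph induced by [C] are renumbered by ['I_#|C|]
    through [enum_val : 'I_#|C| -> 'I_n], whose image is [C]. *)
Definition induced_rel (n : nat) (e : rel 'I_n) (C : {set 'I_n}) :
    rel 'I_#|C| :=
  fun a b => e (enum_val a) (enum_val b).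

Definition markov_mx_on (R : rcfType) (n : nat) (e : rel 'I_n) (v : 'I_n -> R)
    (C : {set 'I_n}) : 'M[R]_#|C| :=
  markov_mx (@induced_rel n e C) (fun a => v (enum_val a)).

Definition extend0 (R : rcfType) (n : nat) (C : {set 'I_n})
    (x : 'cV[R]_#|C|) : 'cV[R]_n :=
  \col_i (if [pick a : 'I_#|C| | enum_val a == i] is Some a then x a 0 else 0).

(** Matrices act on functions on the nodes, hence on column vectors, unlike
    [eigenspace] and [eigenvalue] of the library, which use row vectors. *)
Definition eigenvector (R : rcfType) (n : nat) (M : 'M[R]_n) (x : 'cV[R]_n) :
    Prop :=
  x != 0 /\ exists a : R, M *m x = a *: x.

Definition complete_eigenvectors (R : rcfType) (n : nat) (M : 'M[R]_n)
    (X : seq 'cV[R]_n) : Prop :=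
  basis_of fullv X /\ (forall x, x \in X -> eigenvector M x).

(** [s] lists all the eigenvalues of [M], each repeated according to its
    algebraic multiplicity; this determines [s] up to permutation.  As the
    characteristic polynomial splits, there are no further eigenvalues in an
    extension of [R]. *)
Definition is_spectrum (R : rcfType) (n : nat) (M : 'M[R]_n) (s : seq R) :
    Prop :=
  char_poly M = \prod_(a <- s) ('X - a%:P).

Definition mean (R : rcfType) (s : seq R) : R :=
  (size s)%:R^-1 * \sum_(a <- s) a.

Definition stddev (R : rcfType) (s : seq R) : R :=
  Num.sqrt ((size s)%:R^-1 * \sum_(a <- s) (a - mean s) ^+ 2).

(* Main.v *)
Require Import Defs.
From HB Require Import structures.
From mathcomp Require Import all_boot all_order all_algebra.
From mathcomp Require Import ring complex.

Set Implicit Arguments.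
Unset Strict Implicit.
Unset Printing Implicit Defensive.

Import Order.TTheory GRing.Theory Num.Theory.

Local Open Scope ring_scope.

(* Over [R[i]] the matrix is hermitian, so its minimal polynomial is a product
   of distinct linear factors with real roots; the minimal polynomial is
   invariant under field extension, so it also splits in this way over [R]. *)
Lemma real_symmetric_diagonalizable (R : rcfType) (n : nat) (S : 'M[R]_n) :
  S^T = S ->
  exists2 P : 'M[R]_n, P \in unitmx & exists d : 'rV_n, S *m P = P *m diag_mx d.
Proof.
case: n S => [|n] S symS.
  (* The minimal polynomial below is that of a matrix of positive size, so dimension zero is settled
     first. *)
  by exists 1%:M; [exact: unitmx1 | exists 0; rewrite !thinmx0].
pose f := real_complex R; pose SC := map_mx f S.
have SCh : SC \is hermsymmx.
  apply/is_hermitianmxP; rewrite expr0 scale1r; apply/matrixP => i j.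
  by rewrite !mxE -{1}symS mxE; exact/esym/conjc_real.
have /orthomx_spectralP SCE := hermitian_normalmx SCh.
have /mxOverP realD := hermitian_spectral_diag_real SCh.
set Q := spectralmx SC in SCE; set D := spectral_diag SC in SCE realD.
(* [Q] conjugates [SC] to the diagonal matrix of [D], whose minimal polynomial has each distinct
   diagonal entry as a simple root. *)
have minSC : mxminpoly SC =
    \prod_(r <- undup [seq D 0 i | i <- enum 'I_n.+1]) ('X - r%:P).
  by rewrite SCE -conjVmx ?spectral_unit// mxminpoly_uconj ?unitmx_inv
       ?spectral_unit// mxminpoly_diag.
have [P Pu] : diagonalizable S.
  apply/diagonalizableP.
  exists (undup [seq complex.Re (D 0 i) | i <- enum 'I_n.+1]).
    exact: undup_uniq.
  rewrite -(dvdp_map f) -mxminpoly_map -/SC minSC map_prod_XsubC /=.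
  (* Each [D 0 i] is real, hence the image under [f] of its real part; injectivity of [f] lets it
     commute with removing duplicates. *)
  suff -> : undup [seq D 0 i | i <- enum 'I_n.+1] =
    [seq f r | r <- undup [seq complex.Re (D 0 i) | i <- enum 'I_n.+1]].
    by rewrite big_map dvdpp.
  rewrite -undup_map_inj; last exact: complexI.
  by congr undup; rewrite -[RHS]map_comp; apply: eq_map => i; exact/esym/RRe_real.
case/similar_diagPex => d /(similarP Pu) PS.
(* [P] satisfies [P *m S = diag_mx d *m P], so the eigenvectors are the columns of its inverse. *)
exists (invmx P); first by rewrite unitmx_inv.
exists d; apply: (canRL (mulKmx Pu)).
by rewrite mulmxA PS -mulmxA mulmxV// mulmx1.
Qed.

Lemma markov_mxE (R : rcfType) (n : nat) (e : rel 'I_n) (v : 'I_n -> R) :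
  (forall i, 0 < v i) ->
  markov_mx e v = \matrix_(i, j) ((v i)^-1 * (e i j)%:R).
Proof.
move=> v_gt0; pose W := diag_mx (\row_i (v i)^-1).
have VW : centrality_mx v *m W = 1%:M.
  rewrite mulmx_diag -diag_const_mx; congr diag_mx; apply/rowP => i.
  by rewrite !mxE mulfV// gt_eqF.
have -> : markov_mx e v = W *m adjacency_mx R e.
  (* A right inverse of a square matrix is its inverse, so [W] equals [invmx (centrality_mx v)]. *)
  have [Vu _] := mulmx1_unit VW.
  by congr (_ *m _); rewrite -[LHS]mulmx1 -VW mulKmx.
by apply/matrixP => i j; rewrite mul_diag_mx !mxE.
Qed.

(* [V^-1 A] is conjugate, through the square root of [V], to the symmetric
   matrix [V^(-1/2) A V^(-1/2)]. *)
Lemma markov_mx_diagonalizable (R : rcfType) (n : nat) (e : rel 'I_n)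
    (v : 'I_n -> R) :
  symmetric e -> (forall i, 0 < v i) ->
  exists2 P : 'M[R]_n, P \in unitmx &
    exists d : 'rV_n, markov_mx e v *m P = P *m diag_mx d.
Proof.
move=> e_sym v_gt0; pose w i := (Num.sqrt (v i))^-1.
pose S : 'M[R]_n := \matrix_(i, j) (w i * (e i j)%:R * w j).
have [|Q Qu [d SQ]] := @real_symmetric_diagonalizable R n S.
  by apply/matrixP => i j; rewrite !mxE e_sym mulrC (mulrC (w j)) mulrA.
pose W := diag_mx (\row_i w i).
have ww i : w i * w i = (v i)^-1.
  by rewrite -invfM -expr2 sqr_sqrtr// ltW.
have Wu : W \in unitmx.
  rewrite unitmxE det_diag unitfE.
  by apply/prodf_neq0 => i _; rewrite mxE invr_neq0// sqrtr_eq0 -ltNge.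
(* Since [markov_mx e v *m W = W *m S], with both entries equal to [w i * w i * (e i j)%:R * w j],
   [W] carries the eigenvectors of [S] to those of the Markov matrix. *)
exists (W *m Q); first by rewrite unitmx_mul Wu.
exists d; rewrite -[RHS]mulmxA -SQ !mulmxA; congr (_ *m _).
rewrite markov_mxE//; apply/matrixP => i j.
by rewrite mul_diag_mx mul_mx_diag !mxE !mulrA ww.
Qed.

(** * Bases of eigenvectors *)

(** A spanning family with as many members as the dimension is free, so linear independence never
    has to be checked directly. *)
Lemma basis_cVP (F : fieldType) (n : nat) (X : seq 'cV[F]_n) :
  reflect ((forall x, x \in <<X>>%VS) /\ size X = n) (basis_of fullv X).
Proof.
have dimE : \dim (@fullv F 'cV[F]_n) = n by rewrite dimvf /dim /= muln1.
apply: (iffP idP) => [|[spanX sizeX]].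
  rewrite -[X in basis_of _ X]/(tval (in_tuple X)) => XB.
  split=> [x|]; first by rewrite (span_basis XB) memvf.
  by rewrite -[RHS]dimE (size_basis XB).
by rewrite basisEdim dimE sizeX leqnn andbT; apply/subvP.
Qed.

Lemma complete_eigenvectors_cols (R : rcfType) (n : nat) (M P : 'M[R]_n)
    (d : 'rV_n) :
  P \in unitmx -> M *m P = P *m diag_mx d ->
  complete_eigenvectors M [seq col j P | j <- enum 'I_n].
Proof.
move=> Pu MP; set X := map _ _.
have XB : basis_of fullv X.
  apply/basis_cVP; split=> [x|]; last by rewrite size_map size_enum_ord.
  (* The coordinates of [x] in the columns of [P] are the entries of [invmx P *m x]. *)
  have -> : x = \sum_j (invmx P *m x) j 0 *: col j P.
    rewrite -[LHS](mulKVmx Pu); apply/colP => i.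
    by rewrite mxE summxE; apply: eq_bigr => j _; rewrite !mxE mulrC.
  apply: rpred_sum => j _; apply/rpredZ/memv_span/map_f.
  by rewrite mem_enum.
split=> // x xX; split; first exact: free_not0 (basis_free XB) xX.
have /mapP[j _ ->] := xX; exists (d 0 j).
rewrite {1}colE mulmxA MP -colE mul_mx_diag.
by apply/colP => i; rewrite !mxE mulrC.
Qed.

(** * Extension by zero and connected components *)

(** The matrix is that of the inclusion of [C] into the nodes; this form makes extension by zero
    visibly linear, hence compatible with scalars and spans. *)
Lemma extend0E (R : rcfType) (n : nat) (C : {set 'I_n}) (x : 'cV[R]_#|C|) :
  extend0 x = (\matrix_(i, a) (enum_val a == i)%:R) *m x.
Proof.
apply/colP => i; rewrite !mxE; case: pickP => [a /eqP <-|no_a].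
  rewrite (bigD1 a)//= mxE eqxx mul1r big1 ?addr0// => b b_neq_a.
  by rewrite mxE (inj_eq enum_val_inj) (negPf b_neq_a) mul0r.
by rewrite big1// => a _; rewrite mxE no_a mul0r.
Qed.

Lemma extend0_val (R : rcfType) (n : nat) (C : {set 'I_n}) (x : 'cV[R]_#|C|) a :
  extend0 x (enum_val a) 0 = x a 0.
Proof.
rewrite mxE; case: pickP => [b /eqP/enum_val_inj -> //|/(_ a)].
by rewrite eqxx.
Qed.

Lemma extend0_out (R : rcfType) (n : nat) (C : {set 'I_n}) (x : 'cV[R]_#|C|) i :
  i \notin C -> extend0 x i 0 = 0.
Proof.
move=> iNC; rewrite mxE; case: pickP => [a /eqP ai|//].
by rewrite -ai enum_valP in iNC.
Qed.

Lemma extend0_eq0 (R : rcfType) (n : nat) (C : {set 'I_n}) (x : 'cV[R]_#|C|) :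
  (extend0 x == 0) = (x == 0).
Proof.
apply/eqP/eqP => [x0|->]; last by rewrite extend0E mulmx0.
by apply/colP => a; rewrite -extend0_val x0 !mxE.
Qed.

Lemma extend0_span (R : rcfType) (n : nat) (C : {set 'I_n})
    (X : seq 'cV[R]_#|C|) x :
  x \in <<X>>%VS -> extend0 x \in <<[seq extend0 y | y <- X]>>%VS.
Proof.
pose E : 'M[R]_(n, #|C|) := \matrix_(i, a) (enum_val a == i)%:R.
have EE y : extend0 y = linfun (mulmx E) y by rewrite lfunE extend0E.
by move=> xX; rewrite EE (eq_map EE) -limg_span memv_img.
Qed.

(** No edge crosses the boundary of [C]. Rows in [C] therefore meet the extended vector exactly as
    in the induced subgraph, and rows outside [C] vanish on the columns of [C]. This intertwining
    turns eigenvectors of the subgraph into eigenvectors of the whole graph. *)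
Lemma markov_mx_extend0 (R : rcfType) (n : nat) (e : rel 'I_n)
    (v : 'I_n -> R) (C : {set 'I_n}) (x : 'cV[R]_#|C|) :
  (forall i, 0 < v i) -> (forall i j, e i j -> (i \in C) = (j \in C)) ->
  markov_mx e v *m extend0 x = extend0 (markov_mx_on e v C *m x).
Proof.
move=> v_gt0 eC; rewrite /markov_mx_on !markov_mxE//.
apply/colP => i; rewrite mxE (bigID (mem C))/= [X in _ + X]big1 ?addr0; last first.
  by move=> j jNC; rewrite extend0_out ?mulr0.
rewrite big_enum_val; have [iC|iNC] := boolP (i \in C).
  rewrite -(enum_rankK_in iC iC) extend0_val mxE; apply: eq_bigr => a _.
  by rewrite extend0_val !mxE.
rewrite extend0_out// big1// => a _; rewrite mxE.
have [/eC|] := boolP (e i (enum_val a)); last by rewrite mulr0 mul0r.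
by rewrite enum_valP (negPf iNC).
Qed.

Lemma components_partition (n : nat) (e : rel 'I_n) :
  symmetric e -> partition (components e) [set: 'I_n].
Proof.
move=> e_sym; apply: equivalence_partitionP => i j k _ _ _.
split=> [|ij]; first exact: connect0.
exact: (same_connect (sym_connect_sym e_sym) ij).
Qed.

Lemma edge_component (n : nat) (e : rel 'I_n) (C : {set 'I_n}) i j :
  symmetric e -> C \in components e -> e i j -> (i \in C) = (j \in C).
Proof.
move=> e_sym /imsetP[k _ ->] eij; rewrite !inE.
by rewrite (same_connect_r (sym_connect_sym e_sym) (connect1 eij)).
Qed.

(** The components partition the nodes, so the sizes of the local bases add up to [n]. The extended
    vectors span because each standard basis vector is the extension of one in the component [C] of
    its node, and that one lies in the span of [X C]. *)
Lemma complete_eigenvectors_extend0 (R : rcfType) (n : nat) (e : rel 'I_n)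
    (v : 'I_n -> R) (X : forall C : {set 'I_n}, seq 'cV[R]_#|C|) :
  symmetric e -> (forall i, 0 < v i) ->
  (forall C, C \in components e ->
     complete_eigenvectors (markov_mx_on e v C) (X C)) ->
  complete_eigenvectors (markov_mx e v)
    (flatten [seq [seq extend0 x | x <- X C] | C <- enum (components e)]).
Proof.
move=> e_sym v_gt0 XP.
have compP := components_partition e_sym; split; last first.
  move=> z /flatten_mapP[C]; rewrite mem_enum => Ce /mapP[x xX ->].
  have [_ /(_ x xX)[x_neq0 [a Mx]]] := XP C Ce.
  split; first by rewrite extend0_eq0.
  exists a; rewrite markov_mx_extend0//; last by move=> i j; exact: edge_component.
  by rewrite Mx !extend0E scalemxAr.
apply/basis_cVP; split=> [x|]; last first.
  rewrite size_flatten /shape -map_comp sumnE big_map big_enum/=.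
  rewrite -[RHS]card_ord -cardsT (card_partition compP).
  apply: eq_bigr => C Ce; rewrite size_map.
  by have [/basis_cVP[]] := XP C Ce.
have -> : x = \sum_i x i 0 *: delta_mx i 0.
  rewrite {1}(matrix_sum_delta x); apply: eq_bigr => i _.
  by rewrite big_ord1.
apply: rpred_sum => i _; apply: rpredZ.
pose C := pblock (components e) i.
have iC : i \in C by rewrite mem_pblock (cover_partition compP).
have Ce : C \in components e by rewrite pblock_mem// (cover_partition compP).
have -> : delta_mx i 0 = extend0 (delta_mx (enum_rank_in iC i) 0) :> 'cV[R]_n.
  apply/colP => j; have [jC|jNC] := boolP (j \in C).
    rewrite -(enum_rankK_in iC jC) extend0_val !mxE (enum_rankK_in iC jC).
    by rewrite (can_in_eq (enum_rankK_in iC)).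
  by rewrite extend0_out// mxE; case: eqP jNC => // ->; rewrite iC.
have [/basis_cVP[spanX _] _] := XP C Ce.
apply: subvP (extend0_span (spanX _)); apply: sub_span => y yX.
by apply/flatten_mapP; exists C; rewrite ?mem_enum.
Qed.

(** * Spectrum, traces and moments *)

(** Over polynomials, [P] intertwines the two characteristic matrices; taking determinants, the
    factor [\det PX] cancels because it is a nonzero constant. *)
Lemma char_poly_similar (F : fieldType) (n : nat) (M N P : 'M[F]_n) :
  P \in unitmx -> M *m P = P *m N -> char_poly M = char_poly N.
Proof.
move=> Pu MP; pose PX := map_mx polyC P.
have detPX : \det PX != 0.
  by rewrite det_map_mx polyC_eq0 -unitfE -unitmxE.
apply: (mulIf detPX); rewrite [RHS]mulrC -!det_mulmx; congr (\det _).
rewrite /char_poly_mx mulmxBl mulmxBr -!map_mxM MP; congr (_ - _).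
by rewrite scalar_mxC.
Qed.

Lemma mxtrace_similar (F : fieldType) (n : nat) (M N P : 'M[F]_n) :
  P \in unitmx -> M *m P = P *m N -> \tr M = \tr N.
Proof. by move=> Pu MP; rewrite -[M](mulmxK Pu) MP mxtrace_mulC mulKmx. Qed.

Lemma spectrum_diagonal (R : rcfType) (n : nat) (M P : 'M[R]_n) (d : 'rV_n) :
  P \in unitmx -> M *m P = P *m diag_mx d ->
  is_spectrum M [seq d 0 i | i <- enum 'I_n].
Proof.
move=> Pu MP; rewrite /is_spectrum (char_poly_similar Pu MP).
rewrite char_poly_trig ?diag_mx_is_trig// big_map big_enum.
by apply: eq_bigr => i _; rewrite mxE eqxx mulr1n.
Qed.

(** The product of the ['X - a%:P] determines its roots up to order, so [s] is a permutation of the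
    entries of [d]. Its first two power sums are the traces of [diag_mx d] and its square, and
    traces are invariant under similarity. *)
Lemma spectrum_moments (R : rcfType) (n : nat) (M P : 'M[R]_n) (d : 'rV_n)
    (s : seq R) :
  P \in unitmx -> M *m P = P *m diag_mx d -> is_spectrum M s ->
  [/\ size s = n, \sum_(a <- s) a = \tr M
    & \sum_(a <- s) a ^+ 2 = \tr (M *m M)].
Proof.
move=> Pu MP sM; have := spectrum_diagonal Pu MP.
rewrite /is_spectrum sM => /prod_XsubC_eq s_d.
split; first by rewrite (perm_size s_d) size_map size_enum_ord.
  by rewrite (perm_big _ s_d) big_map big_enum (mxtrace_similar Pu MP) mxtrace_diag.
have MMP : M *m M *m P = P *m (diag_mx d *m diag_mx d).
  by rewrite -mulmxA MP !mulmxA MP.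
rewrite (perm_big _ s_d) big_map big_enum (mxtrace_similar Pu MMP).
rewrite mulmx_diag mxtrace_diag.
by apply: eq_bigr => i _; rewrite mxE expr2.
Qed.

Lemma stddevE (R : rcfType) (s : seq R) :
  stddev s =
    Num.sqrt ((size s)%:R^-1 * (\sum_(a <- s) a ^+ 2) - mean s ^+ 2).
Proof.
rewrite /stddev; congr Num.sqrt; case: s => [|b s'].
  (* For the empty list, the spectrum when the graph has no nodes, all sums vanish; the general
     computation divides by the size. *)
  by rewrite /mean !big_nil !mulr0 expr0n subr0.
set s := b :: s'; set m := mean s.
have size_neq0 : (size s)%:R != 0 :> R by rewrite pnatr_eq0.
have sum_s : \sum_(a <- s) a = (size s)%:R * m by rewrite mulVKf.
have -> : \sum_(a <- s) (a - m) ^+ 2 =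
    \sum_(a <- s) a ^+ 2 - (size s)%:R * m ^+ 2.
  under eq_bigr do rewrite sqrrB.
  rewrite big_split/= sumrB sumrMnl -mulr_suml sum_s.
  by rewrite big_const_seq count_predT iter_addr_0 -mulr_natl; ring.
by rewrite mulrBr mulKf.
Qed.

Theorem proposition3p3p2 (R : rcfType) (n : nat) (e : rel 'I_n)
    (v : 'I_n -> R) (he : symmetric e) (hv : forall i, 0 < v i) :
  ((1 < #|components e|)%N ->
    (forall C, C \in components e ->
       exists X : seq 'cV[R]_#|C|,
         complete_eigenvectors (markov_mx_on e v C) X) /\
    (forall X : (forall C : {set 'I_n}, seq 'cV[R]_#|C|),
       (forall C, C \in components e ->
          complete_eigenvectors (markov_mx_on e v C) (X C)) ->
       complete_eigenvectors (markov_mx e v)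
         (flatten [seq [seq extend0 x | x <- X C]
                  | C <- enum (components e)]))) /\
  ((exists s : seq R, is_spectrum (markov_mx e v) s) /\
   (forall s : seq R, is_spectrum (markov_mx e v) s ->
      (reflexive e -> mean s = n%:R^-1 * \sum_i (v i)^-1) /\
      stddev s =
        Num.sqrt (n%:R^-1 * (\sum_i \sum_(j | e i j) (v i * v j)^-1)
                  - mean s ^+ 2))).
Proof.
have [P Pu [d MP]] := markov_mx_diagonalizable he hv.
split.
  move=> _; split=> [C Ce|X XP]; last exact: complete_eigenvectors_extend0.
  (* The induced subgraph inherits symmetry and positive centralities, so its Markov matrix is
     diagonalizable too. *)
  have [||Q Qu [c MQ]] := @markov_mx_diagonalizable R #|C|
    (@induced_rel n e C) (fun a => v (enum_val a)).
  - by move=> a b; exact: he.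
  - by move=> a; exact: hv.
  - by exists [seq col j Q | j <- enum 'I_#|C|]; exact: complete_eigenvectors_cols MQ.
split=> [|s sM]; first by eexists; exact: spectrum_diagonal MP.
have [size_s sum_s sum_sqr_s] := spectrum_moments Pu MP sM.
split=> [e_refl|].
  rewrite /mean size_s sum_s markov_mxE//; congr (_ * _).
  (* The loop at [i] makes the diagonal entry [(v i)^-1]. *)
  by apply: eq_bigr => i _; rewrite mxE e_refl mulr1.
rewrite stddevE size_s sum_sqr_s markov_mxE//; congr (Num.sqrt (_ * _ - _)).
apply: eq_bigr => i _; rewrite mxE [RHS]big_mkcond; apply: eq_bigr => j _.
(* The trace of the square pairs the entries at [(i, j)] and [(j, i)]; by symmetry the product of
   their edge indicators is the indicator of [e i j] alone. *)
rewrite !mxE (he j i) mulrACA -invfM -natrM mulnb andbb.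
by case: (e i j); rewrite ?mulr1 ?mulr0.
Qed.
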